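(* Let $\ell \in \mathbb{N}$ be a positive integer and let $\mathcal{A} \subset \mathscr{P}(\mathbb{N}_0)$ be a Furstenberg family. Let $f:X\to X$ be a continuous map on a metric space $(X,d)$, let $\overline{f}:\mathcal{K}(X)\to\mathcal{K}(X)$ be the induced map on the hyperspace of non-empty compact subsets of $X$, and let $\hat{f}$ be the Zadeh extension of $f$ to the space $\mathcal{F}(X)$ of normal fuzzy sets, where $\mathcal{F}_\infty(X)=(\mathcal{F}(X),d_\infty)$ and $\mathcal{F}_0(X)=(\mathcal{F}(X),d_0)$ denote this space with the supremum metric and with the Skorokhod metric, respectively. Then the following statements are equivalent: (i) $f_{(N)}:X^N\to X^N$ is topologically $(\ell,\mathcal{A})$-recurrent for every $N \in \mathbb{N}$; (ii) $\overline{f}:\mathcal{K}(X)\to \mathcal{K}(X)$ is topologically $(\ell,\mathcal{A})$-recurrent; (iii) $\hat{f}:\mathcal{F}_{\infty}(X)\to \mathcal{F}_{\infty}(X)$ is topologically $(\ell,\mathcal{A})$-recurrent; (iv) $\hat{f}:\mathcal{F}_{0}(X)\to \mathcal{F}_{0}(X)$ is topologically $(\ell,\mathcal{A})$-recurrent.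
   Context: $\mathbb{N}$ is the set of strictly positive integers and $\mathbb{N}_0=\mathbb{N}\cup\{0\}$; $\mathscr{P}(\mathbb{N}_0)$ is the power set of $\mathbb{N}_0$. Furstenberg family: a collection $\mathcal{A}\subset\mathscr{P}(\mathbb{N}_0)$ that is hereditarily upward (if $A\in\mathcal{A}$ and $A\subset B\subset\mathbb{N}_0$, then $B\in\mathcal{A}$) and such that $\varnothing\notin\mathcal{A}$. For a continuous self-map $g:Y\to Y$ of a topological space $Y$ and $N\in\mathbb{N}$, $g_{(N)}:Y^N\to Y^N$ denotes the $N$-fold direct product $g_{(N)}(y_1,\dots,y_N)=(g(y_1),\dots,g(y_N))$, where $Y^N$ carries the product topology. Topological $(\ell,\mathcal{A})$-recurrence: a continuous self-map $g:Y\to Y$ of a topological space $Y$ is topologically $(\ell,\mathcal{A})$-recurrent if for every non-empty open subset $U\subset Y$ the set $$\mathcal{N}_g^{\ell}(U):=\left\{ n\in\mathbb{N}_0 \;;\; U\cap g^{-n}(U)\cap g^{-2n}(U)\cap\cdots\cap g^{-\ell n}(U)\neq\varnothing \right\}$$ belongs to $\mathcal{A}$, where $g^{-m}(U)$ is the preimage of $U$ under the $m$-th iterate $g^m$ (with $g^0=\mathrm{id}$). $\mathcal{K}(X)$ is the set of all non-empty compact subsets of $X$, endowed with the Vietoris topology, whose basic open sets are $\mathcal{V}(U_1,\dots,U_N)=\{K\in\mathcal{K}(X)\;;\;K\subset\bigcup_{j=1}^N U_j,\ K\cap U_j\neq\varnothing \text{ for all } 1\le j\le N\}$ with $N\in\mathbb{N}$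 and $U_1,\dots,U_N\subset X$ non-empty open; for a metric space $(X,d)$ this is the topology of the Hausdorff metric $d_H(K_1,K_2)=\max\{\max_{x_1\in K_1}d(x_1,K_2),\max_{x_2\in K_2}d(x_2,K_1)\}$. The map $\overline{f}:\mathcal{K}(X)\to\mathcal{K}(X)$ is $\overline{f}(K):=f(K)$. Fuzzy sets: for a function $u:X\to[0,1]$ put $u_\alpha:=\{x\in X\;;\;u(x)\ge\alpha\}$ for $\alpha\in(0,1]$ and $u_0:=\overline{\{x\in X\;;\;u(x)>0\}}$ (closure in $X$). $\mathcal{F}(X)$ is the set of normal fuzzy sets: the upper-semicontinuous functions $u:X\to[0,1]$ such that $u_0$ is compact and $u_1$ is non-empty. Zadeh extension: $\hat{f}(u)(x):=\sup\{u(y)\;;\;y\in f^{-1}(x)\}$ if $f^{-1}(x)\neq\varnothing$, and $\hat{f}(u)(x):=0$ if $f^{-1}(x)=\varnothing$. For continuous $f$ on a metric space, $\hat f$ is a well-defined self-map of $\mathcal{F}(X)$, continuous for both metrics below. Supremum metric: $d_\infty(u,v):=\sup_{\alpha\in[0,1]}d_H(u_\alpha,v_\alpha)$ for $u,v\in\mathcal{F}(X)$. Skorokhod metric: $d_0(u,v):=\inf\{\varepsilon\;;\;\text{there is }\xi\in\mathcal{T}\text{ with }\sup_{\alpha\in[0,1]}|\xi(\alpha)-\alpha|\le\varepsilon\text{ and }d_\infty(u,\xi\circ v)\le\varepsilon\}$, where $\mathcal{T}$ is the set of strictly increasing homeomorphisms $\xi:[0,1]\to[0,1]$. *)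

(* Defs.v *)
From HB Require Import structures.
From mathcomp Require Import all_boot all_order all_algebra.
From mathcomp Require Import all_classical all_reals all_analysis.

Set Implicit Arguments.
Unset Strict Implicit.
Unset Printing Implicit Defensive.

Import Order.TTheory GRing.Theory Num.Theory.
Import numFieldTopology.Exports.

Local Open Scope classical_set_scope.
Local Open Scope ring_scope.

Definition furstenberg_family (F : set (set nat)) : Prop :=
  (forall A B : set nat, F A -> A `<=` B -> F B) /\ ~ F set0.

Definition return_set (Y : Type) (l : nat) (g : Y -> Y) (U : set Y) : set nat :=
  [set n | \bigcap_(i in `I_l.+1) (iter (i * n)%N g @^-1` U) !=set0].

(* To be used for continuous [g] only; continuity is not repeated here. *)
Definition topologically_recurrent (Y : topologicalType) (l : nat)
    (F : set (set nat)) (g : Y -> Y) : Prop :=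
  forall U : set Y, open U -> U !=set0 -> F (return_set l g U).

Definition fold_product (X : topologicalType) (N : nat) (f : X -> X) :
    {ptws 'I_N -> X} -> {ptws 'I_N -> X} :=
  fun y i => f (y i).

Section Hyperspace.
Variable X : topologicalType.

Record hyperspace := Hyperspace {
  hyperspace_set :> set X ;
  hyperspaceP : compact hyperspace_set /\ hyperspace_set !=set0 }.

HB.instance Definition _ := gen_eqMixin hyperspace.
HB.instance Definition _ := gen_choiceMixin hyperspace.

Definition vietoris_index : set (nat * (nat -> set X)) :=
  [set NU | (0 < NU.1)%N /\
    forall j, (j < NU.1)%N -> open (NU.2 j) /\ NU.2 j !=set0].

Definition vietoris (NU : nat * (nat -> set X)) : set hyperspace :=
  [set K | (K : set X) `<=` \bigcup_(j in `I_(NU.1)) NU.2 j /\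
    forall j, (j < NU.1)%N -> K `&` NU.2 j !=set0].

Lemma vietoris_cover : \bigcup_(NU in vietoris_index) vietoris NU = setT.
Proof.
apply/seteqP; split => // K _.
have [cK [x Kx]] := hyperspaceP K.
exists (1%N, fun=> setT); first by split=> // j _; split; [exact: openT|exists x].
by split; [move=> y _; exists 0%N|move=> j _; exists x].
Qed.

Lemma vietoris_join (NU MV : nat * (nat -> set X)) (K : hyperspace) :
  vietoris_index NU -> vietoris_index MV -> vietoris NU K -> vietoris MV K ->
  exists PW, [/\ vietoris_index PW, vietoris PW K &
    vietoris PW `<=` vietoris NU `&` vietoris MV].
Proof.
case: NU MV => [N U] [M V] [/= N0 oU] [/= M0 oV] [/= KU1 KU2] [/= KV1 KV2].
pose cU := \bigcup_(j in `I_N) U j; pose cV := \bigcup_(j in `I_M) V j.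
pose W j := if (j < N)%N then U j `&` cV else V (j - N)%N `&` cU.
have ocU : open cU by apply: bigcup_open => j /= jN; case: (oU j jN).
have ocV : open cV by apply: bigcup_open => j /= jN; case: (oV j jN).
have ltNM j : (j < N + M)%N -> (j < N)%N = false -> (j - N < M)%N.
  by move=> jNM /negbT; rewrite -leqNgt => Nj; rewrite ltn_subLR.
have KW j : (j < N + M)%N -> K `&` W j !=set0.
  move=> jNM; rewrite /W; case: ifPn => [jN|/negbTE jN].
    by have [x [Kx Ux]] := KU2 _ jN; exists x; split => //; split => //; exact: KV1.
  have [x [Kx Vx]] := KV2 _ (ltNM _ jNM jN).
  by exists x; split => //; split => //; exact: KU1.
have WU j : (j < N)%N -> W j = U j `&` cV by rewrite /W => ->.
have WV j : W (N + j)%N = V j `&` cU.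
  by rewrite /W ltnNge leq_addr /= addKn.
exists ((N + M)%N, W); split => /=.
- split => /=; first by rewrite addn_gt0 N0.
  move=> j jNM; split; last by have [x [_ Wx]] := KW _ jNM; exists x.
  rewrite /W; case: ifPn => [jN|/negbTE jN]; apply: openI => //.
    by have [] := oU _ jN.
  by have [] := oV _ (ltNM _ jNM jN).
- split => // x Kx /=.
  have [j jN Ux] := KU1 _ Kx; exists j; first by rewrite /= ltn_addr.
  by rewrite WU//; split => //; exact: KV1.
- move=> L [/= LW1 LW2]; split; split => /=.
  + move=> x /LW1[j jNM]; rewrite /W; case: ifPn => [jN [Ux _]|_ [_ //]].
    by exists j.
  + move=> j jN; have [|x [Lx]] := LW2 j; first by rewrite ltn_addr.
    by rewrite WU// => -[Ux _]; exists x.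
  + move=> x /LW1[j /= jNM]; rewrite /W; case: ifPn => [_ [_ //]|/negbTE jN [Vx _]].
    by exists (j - N)%N => //; exact: ltNM.
  + move=> j jM; have [|x [Lx]] := LW2 (N + j)%N; first by rewrite ltn_add2l.
    by rewrite WV => -[Vx _]; exists x.
Qed.

HB.instance Definition _ :=
  isBaseTopological.Build hyperspace vietoris_cover vietoris_join.

Lemma hyper_map_subproof (f : X -> X) (cf : continuous f) (K : hyperspace) :
  compact (f @` K) /\ f @` K !=set0.
Proof.
have [cK [x Kx]] := hyperspaceP K; split; last by exists (f x); exists x.
by apply: continuous_compact => //; exact: continuous_subspaceT.
Qed.

Definition hyper_map (f : X -> X) (cf : continuous f) (K : hyperspace) :
  hyperspace := Hyperspace (hyper_map_subproof cf K).

End Hyperspace.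

Section Fuzzy_definitions.
Context {R : realType} {X : metricType R}.
Implicit Types (u v : X -> R) (A B : set X).

Definition dist_set (x : X) A : R := inf [set mdist x y | y in A].

Definition hausdorff_dist A B : R :=
  Num.max (sup [set dist_set x B | x in A]) (sup [set dist_set y A | y in B]).

Definition upper_semicontinuous u : Prop :=
  forall x a, u x < a -> \forall y \near x, u y < a.

Definition level u (a : R) : set X :=
  if a == 0 then closure [set x | 0 < u x] else [set x | a <= u x].

Definition normal_fuzzy u : Prop :=
  [/\ forall x, 0 <= u x <= 1, upper_semicontinuous u,
      compact (level u 0) & level u 1 !=set0].

Definition zadeh_fun (f : X -> X) u (x : X) : R :=
  if `[< f @^-1` [set x] !=set0 >] then sup [set u y | y in f @^-1` [set x]]
  else 0.

Definition sup_dist u v : R :=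
  sup [set hausdorff_dist (level u a) (level v a) | a in `[0, 1]].

(* [xi] represents a self-map of [0, 1]; only its values there matter. *)
Definition increasing_homeo (xi : R -> R) : Prop :=
  {in `[0, 1] &, {homo xi : a b / a < b}} /\
  exists zeta : R -> R,
    [/\ set_fun `[0, 1] `[0, 1] xi, set_fun `[0, 1] `[0, 1] zeta,
        {in `[0, 1], cancel xi zeta} & {in `[0, 1], cancel zeta xi}] /\
    ({within `[0, 1], continuous xi} /\ {within `[0, 1], continuous zeta}).

Definition skorokhod_dist u v : R :=
  inf [set e | exists xi : R -> R, [/\ increasing_homeo xi,
    sup [set `|xi a - a| | a in `[0, 1]] <= e & sup_dist u (xi \o v) <= e]].

End Fuzzy_definitions.

Section Fuzzy_theory.
Context {R : realType} {X : metricType R}.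
Implicit Types (u v w : X -> R) (A B C : set X) (a b e : R).

Definition ncompact A := compact A /\ A !=set0.

Lemma dist_set_ge0 x A : 0 <= dist_set x A.
Proof.
have [[y Ay]|/set0P/negP/negPn/eqP ->] := pselect (A !=set0); last first.
  by rewrite /dist_set image_set0 inf0.
by apply: lb_le_inf; [exists (mdist x y), y|move=> _ [z _ <-]; exact: mdist_ge0].
Qed.

Lemma dist_set_le x y A : A y -> dist_set x A <= mdist x y.
Proof.
move=> Ay; apply: ge_inf; last by exists y.
by exists 0 => _ [z _ <-]; exact: mdist_ge0.
Qed.

Lemma dist_set_lt x A e : A !=set0 -> dist_set x A < e ->
  exists2 y, A y & mdist x y < e.
Proof.
move=> [z Az] /inf_lt[]; first by exists (mdist x z), z.
by move=> _ [y Ay <-] ye; exists y.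
Qed.

Lemma compact_mdist_bounded A x : compact A ->
  exists M, forall y, A y -> mdist y x <= M.
Proof.
move=> /compact_near_coveringP cA.
have : \forall M \near +oo, A `<=` (fun y => mdist y x <= M).
  apply: cA => y Ay; exists (ball y 1, [set M | mdist y x + 1 < M]) => /=.
    by split; [exact: nbhsx_ballx|exact: nbhs_pinfty_gt (num_real _)].
  move=> [z M]/= [yz yM]; apply/ltW/(le_lt_trans _ yM).
  rewrite (le_trans (metric_triangle _ y _))// addrC lerD2l.
  by move: yz; rewrite ballEmdist/= metric_sym => /ltW.
by move=> [M [_ /(_ (M + 1))]]; rewrite ltrDl ltr01 => /(_ isT) h; exists (M + 1).
Qed.

Lemma hausdorff_dist_le A B e : A !=set0 -> B !=set0 ->
  (forall x, A x -> dist_set x B <= e) -> (forall y, B y -> dist_set y A <= e) ->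
  hausdorff_dist A B <= e.
Proof.
move=> [x Ax] [y By] hA hB; rewrite /hausdorff_dist ge_max; apply/andP; split.
  by apply: ge_sup; [exists (dist_set x B), x|move=> _ [z Az <-]; exact: hA].
by apply: ge_sup; [exists (dist_set y A), y|move=> _ [z Az <-]; exact: hB].
Qed.

Lemma hausdorff_distC A B : hausdorff_dist A B = hausdorff_dist B A.
Proof. by rewrite /hausdorff_dist maxC. Qed.

Lemma dist_set_le_hausdorff A B x : compact A -> B !=set0 -> A x ->
  dist_set x B <= hausdorff_dist A B.
Proof.
move=> cA [b Bb] Ax; rewrite /hausdorff_dist le_max; apply/orP; left.
apply: ub_le_sup; last by exists x.
have [M hM] := compact_mdist_bounded b cA.
by exists M => _ [y Ay <-]; rewrite (le_trans (dist_set_le _ Bb))// hM.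
Qed.

Lemma hausdorff_dist_ge0 A B : ncompact A -> ncompact B -> 0 <= hausdorff_dist A B.
Proof.
move=> [cA [x Ax]] [cB B0].
exact: le_trans (dist_set_ge0 x B) (dist_set_le_hausdorff cA B0 Ax).
Qed.

Lemma dist_setxx A x : A x -> dist_set x A = 0.
Proof.
by move=> Ax; apply/eqP; rewrite eq_le dist_set_ge0 andbT -(mdistxx x) dist_set_le.
Qed.

Lemma hausdorff_distxx A : ncompact A -> hausdorff_dist A A = 0.
Proof.
move=> [cA A0]; apply/eqP; rewrite eq_le hausdorff_dist_ge0 ?andbT //.
by apply: hausdorff_dist_le => // x Ax; rewrite dist_setxx.
Qed.

Lemma dist_set_triangle A B x : ncompact A -> ncompact B ->
  dist_set x B <= dist_set x A + hausdorff_dist A B.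
Proof.
move=> [cA A0] [cB B0]; apply/ler_addgt0Pr => e e0.
have [y Ay xy] : exists2 y, A y & mdist x y < dist_set x A + e / 2.
  by apply: dist_set_lt => //; rewrite ltrDl divr_gt0.
have [z Bz yz] : exists2 z, B z & mdist y z < hausdorff_dist A B + e / 2.
  apply: dist_set_lt => //.
  apply: le_lt_trans (dist_set_le_hausdorff cA B0 Ay) _.
  by rewrite ltrDl divr_gt0.
apply: le_trans (dist_set_le x Bz) _.
apply: le_trans (metric_triangle _ y _) _.
rewrite [e]splitr addrACA; exact/ltW/ltrD.
Qed.

Lemma hausdorff_dist_triangle A B C : ncompact A -> ncompact B -> ncompact C ->
  hausdorff_dist A C <= hausdorff_dist A B + hausdorff_dist B C.
Proof.
move=> kA kB kC; have [[cA A0] [cB B0] [cC C0]] := And3 kA kB kC.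
apply: hausdorff_dist_le => // x Ax.
  apply: le_trans (dist_set_triangle x kB kC) _.
  by rewrite lerD2r dist_set_le_hausdorff.
apply: le_trans (dist_set_triangle x kB kA) _.
rewrite addrC (hausdorff_distC A B) lerD2l hausdorff_distC.
exact: dist_set_le_hausdorff.
Qed.

Lemma usc_closed u : upper_semicontinuous u <->
  forall a, closed [set x | a <= u x].
Proof.
split=> [ucu a|h x a uxa].
  rewrite -openC openE => x /= /negP; rewrite -ltNge => /ucu.
  by apply: filterS => y ya /=; apply/negP; rewrite -ltNge.
have : open (~` [set y | a <= u y]) by rewrite openC.
rewrite openE => /(_ x); rewrite /= /interior => /(_ _) h'.
have := h' ltac:(by apply/negP; rewrite -ltNge).
by apply: filterS => y /= /negP; rewrite -ltNge.
Qed.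

Lemma level_pos u a : 0 < a -> level u a = [set x | a <= u x].
Proof. by rewrite /level => /gt_eqF ->. Qed.

Lemma level0 u : level u 0 = closure [set x | 0 < u x].
Proof. by rewrite /level eqxx. Qed.

Lemma level_sub0 u a : 0 <= a -> level u a `<=` level u 0.
Proof.
rewrite le_eqVlt => /predU1P[<-//|a0]; rewrite level_pos// level0 => x /= ax.
by apply: subset_closure => /=; exact: lt_le_trans ax.
Qed.

Lemma level1_sub u a : 0 <= a <= 1 -> level u 1 `<=` level u a.
Proof.
move=> /andP[]; rewrite le_eqVlt => /predU1P[<- _|a0 a1].
  exact: level_sub0.
by rewrite !level_pos// => x /= /(le_trans a1).
Qed.

Lemma level_ncompact u a : normal_fuzzy u -> 0 <= a <= 1 -> ncompact (level u a).
Proof.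
move=> [u01 ucu cu0 [x ux]] a01; split; last by exists x; exact: level1_sub ux.
apply: subclosed_compact cu0 (@level_sub0 u a _); last by case/andP: a01.
rewrite /level; case: ifPn => _; first exact: closed_closure.
exact: (usc_closed u).1.
Qed.

Lemma sup_dist_ub u v : normal_fuzzy u -> normal_fuzzy v ->
  has_ubound [set hausdorff_dist (level u a) (level v a) | a in `[0, 1]].
Proof.
move=> fu fv; have [u01 ucu cu0 [x ux]] := fu; have [v01 ucv cv0 [y vy]] := fv.
have [M hM] := compact_mdist_bounded y cu0.
have [M' hM'] := compact_mdist_bounded x cv0.
exists (Num.max M M') => _ [a /= aI <-]; move: aI; rewrite in_itv/= => aI.
have a0 : 0 <= a by case/andP: aI.
have [_ ?] := level_ncompact fu aI; have [_ ?] := level_ncompact fv aI.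
apply: hausdorff_dist_le => // z za; rewrite le_max; apply/orP.
  left; apply: le_trans (dist_set_le z (level1_sub aI vy)) _.
  by apply: hM; exact: level_sub0 za.
right; apply: le_trans (dist_set_le z (level1_sub aI ux)) _.
by apply: hM'; exact: level_sub0 za.
Qed.

Lemma sup_dist_leP u v e : normal_fuzzy u -> normal_fuzzy v ->
  sup_dist u v <= e <->
  (forall a, 0 <= a <= 1 -> hausdorff_dist (level u a) (level v a) <= e).
Proof.
move=> fu fv; split=> [uve a aI|h].
  apply: le_trans uve; apply: ub_le_sup; first exact: sup_dist_ub.
  by exists a => //=; rewrite in_itv.
apply: ge_sup; last by move=> _ [a /= aI <-]; apply: h; rewrite in_itv/= in aI.
by exists (hausdorff_dist (level u 0) (level v 0)), 0 => //=;
  rewrite in_itv/= lexx ler01.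
Qed.

Lemma sup_dist_ge u v a : normal_fuzzy u -> normal_fuzzy v -> 0 <= a <= 1 ->
  hausdorff_dist (level u a) (level v a) <= sup_dist u v.
Proof. by move=> fu fv; apply/(sup_dist_leP _ fu fv).1. Qed.

Lemma sup_dist_ge0 u v : normal_fuzzy u -> normal_fuzzy v -> 0 <= sup_dist u v.
Proof.
move=> fu fv; have I0 : 0 <= (0 : R) <= 1 by rewrite lexx ler01.
apply: le_trans (sup_dist_ge fu fv I0).
by apply: hausdorff_dist_ge0; exact: level_ncompact.
Qed.

Lemma sup_distxx u : normal_fuzzy u -> sup_dist u u = 0.
Proof.
move=> fu; apply/eqP; rewrite eq_le sup_dist_ge0// andbT.
apply/(sup_dist_leP _ fu fu) => a aI.
by rewrite hausdorff_distxx//; exact: level_ncompact.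
Qed.

Lemma sup_distC u v : sup_dist u v = sup_dist v u.
Proof.
by rewrite /sup_dist; congr sup; apply/eq_imagel => a _; rewrite hausdorff_distC.
Qed.

Lemma sup_dist_triangle v u w :
  normal_fuzzy u -> normal_fuzzy v -> normal_fuzzy w ->
  sup_dist u w <= sup_dist u v + sup_dist v w.
Proof.
move=> fu fv fw; apply/(sup_dist_leP _ fu fw) => a aI.
apply: le_trans (hausdorff_dist_triangle (level_ncompact fu aI)
  (level_ncompact fv aI) (level_ncompact fw aI)) _.
by apply: lerD; exact: sup_dist_ge.
Qed.

Section Homeo.
Variables (xi zeta : R -> R).
Hypothesis xi_homo : {in `[0, 1] &, {homo xi : a b / a < b}}.
Hypothesis xiI : set_fun `[0, 1] `[0, 1] xi.
Hypothesis zetaI : set_fun `[0, 1] `[0, 1] zeta.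
Hypothesis xiK : {in `[0, 1], cancel xi zeta}.
Hypothesis zetaK : {in `[0, 1], cancel zeta xi}.

Let unitI a := 0 <= a <= 1.

Lemma homeo_itv a : unitI a -> unitI (xi a).
Proof. by move=> aI; have := xiI (x:=a); rewrite /= !in_itv/=; exact. Qed.

Lemma homeo_inv_itv a : unitI a -> unitI (zeta a).
Proof. by move=> aI; have := zetaI (x:=a); rewrite /= !in_itv/=; exact. Qed.

Lemma homeo_lt a b : unitI a -> unitI b -> (xi a < xi b) = (a < b).
Proof.
move=> aI bI; have h := @xi_homo; apply/idP/idP; last first.
  by apply: h; rewrite in_itv.
apply: contraTT; rewrite -!leNgt le_eqVlt => /predU1P[->//|ba].
by apply/ltW/h; rewrite ?in_itv.
Qed.

Lemma homeo_le a b : unitI a -> unitI b -> (xi a <= xi b) = (a <= b).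
Proof. by move=> aI bI; rewrite !leNgt homeo_lt. Qed.

Lemma homeoK a : unitI a -> zeta (xi a) = a.
Proof. by move=> aI; apply: xiK; rewrite in_itv. Qed.

Lemma homeo_invK a : unitI a -> xi (zeta a) = a.
Proof. by move=> aI; apply: zetaK; rewrite in_itv. Qed.

Let I0 : unitI 0. Proof. by rewrite /unitI lexx ler01. Qed.
Let I1 : unitI 1. Proof. by rewrite /unitI lexx ler01. Qed.

Lemma homeo0 : xi 0 = 0.
Proof.
apply/eqP; rewrite eq_le; have /andP[-> _] := homeo_itv I0; rewrite andbT.
rewrite -[leRHS](homeo_invK I0) homeo_le ?homeo_inv_itv//.
by have /andP[] := homeo_inv_itv I0.
Qed.

Lemma homeo1 : xi 1 = 1.
Proof.
apply/eqP; rewrite eq_le; have /andP[_ ->] := homeo_itv I1.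
rewrite -[leLHS](homeo_invK I1) homeo_le ?homeo_inv_itv//.
by have /andP[] := homeo_inv_itv I1.
Qed.

Lemma homeo_inv0 : zeta 0 = 0. Proof. by rewrite -[in LHS]homeo0 homeoK. Qed.

Lemma homeo_inv1 : zeta 1 = 1. Proof. by rewrite -[in LHS]homeo1 homeoK. Qed.

Lemma homeo_inv_gt0 a : unitI a -> 0 < a -> 0 < zeta a.
Proof.
move=> aI a0; rewrite lt_neqAle; have /andP[-> _] := homeo_inv_itv aI.
rewrite andbT; apply: contraTN a0 => /eqP/esym z0.
by rewrite -(homeo_invK aI) z0 homeo0 ltxx.
Qed.

Lemma level_homeo v a : normal_fuzzy v -> unitI a ->
  level (xi \o v) a = level v (zeta a).
Proof.
move=> [v01 _ _ _] aI; have [->|a0] := eqVneq a 0.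
  rewrite homeo_inv0 !level0; congr closure; apply/funext => x /=.
  by rewrite -{1}homeo0 homeo_lt//; exact: v01.
have {}a0 : 0 < a by rewrite lt_neqAle eq_sym a0; case/andP: aI.
rewrite !level_pos ?homeo_inv_gt0//; apply/funext => x /=.
by rewrite -{1}(homeo_invK aI) homeo_le//; [exact: homeo_inv_itv|exact: v01].
Qed.

Lemma normal_fuzzy_homeo v : normal_fuzzy v -> normal_fuzzy (xi \o v).
Proof.
move=> fv; have [v01 ucv cv0 v1] := fv; split.
- by move=> x; exact/homeo_itv/v01.
- apply/usc_closed => a; have [a0|a0] := leP a 0.
    rewrite (_ : mkset _ = setT); first exact: closedT.
    apply/seteqP; split => // x _ /=; rewrite (le_trans a0)//.
    by have /andP[] := homeo_itv (v01 x).
  have [a1|a1] := leP a 1; last first.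
    rewrite (_ : mkset _ = set0); first exact: closed0.
    apply/seteqP; split => // x /=; have /andP[_ h] := homeo_itv (v01 x).
    by move=> /(lt_le_trans a1); rewrite ltNge h.
  have aI : unitI a by rewrite /unitI (ltW a0) a1.
  rewrite -level_pos// level_homeo// level_pos ?homeo_inv_gt0//.
  exact: (usc_closed v).1.
- by rewrite level_homeo// homeo_inv0.
- by rewrite level_homeo// homeo_inv1.
Qed.

Lemma sup_dist_homeo v w : normal_fuzzy v -> normal_fuzzy w ->
  sup_dist (xi \o v) (xi \o w) = sup_dist v w.
Proof.
move=> fv fw; rewrite /sup_dist; congr sup; apply/seteqP; split => _ [a /= aI <-].
  exists (zeta a); first exact: zetaI.
  by rewrite in_itv/= in aI; rewrite !level_homeo.
exists (xi a); first exact: xiI.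
by rewrite in_itv/= in aI; rewrite !level_homeo ?homeo_itv// homeoK.
Qed.

End Homeo.

Lemma increasing_homeo_id : increasing_homeo (@idfun R).
Proof.
split=> //; exists idfun; split; first by split.
by split; apply: continuous_subspaceT => x; exact: cvg_id.
Qed.

Lemma within_continuous_comp_set_fun (T : topologicalType) (A : set T) (g h : T -> T) :
  {within A, continuous g} -> {within A, continuous h} -> set_fun A A h ->
  {within A, continuous (g \o h)}.
Proof.
move=> cg ch hA x.
apply: (@continuous_comp (subspace A) (subspace A) T h g x).
  exact: (@subspaceT_continuous _ _ _ _ (mkfun_fun hA) ch).
exact: cg.
Qed.

Lemma increasing_homeo_comp (xi eta : R -> R) :
  increasing_homeo xi -> increasing_homeo eta -> increasing_homeo (xi \o eta).
Proof.
move=> [hxi [xi' [[xiI xi'I xiK xi'K] [cxi cxi']]]].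
move=> [heta [eta' [[etaI eta'I etaK eta'K] [ceta ceta']]]].
split.
  move=> a b aI bI ab /=; apply: hxi; [exact: etaI|exact: etaI|exact: heta].
exists (eta' \o xi'); split; last by split; exact: within_continuous_comp_set_fun.
split => [a aI|a aI|a aI|a aI] /=.
- exact/xiI/etaI.
- exact/eta'I/xi'I.
- by rewrite xiK ?etaK//; exact: etaI.
- by rewrite eta'K ?xi'K//; exact: xi'I.
Qed.

Lemma increasing_homeo_inv (xi : R -> R) : increasing_homeo xi ->
  exists2 zeta, increasing_homeo zeta &
    [/\ set_fun `[0, 1] `[0, 1] xi, set_fun `[0, 1] `[0, 1] zeta,
        {in `[0, 1], cancel xi zeta} & {in `[0, 1], cancel zeta xi}].
Proof.
move=> [hxi [zeta [[xiI zetaI xiK zetaK] [cxi czeta]]]].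
exists zeta; last by split.
split; last by exists xi.
move=> a b aI bI ab; rewrite ltNge; apply/negP => ba; move: ab; rewrite ltNge.
rewrite -(zetaK a)// -(zetaK b)// => /negP; apply.
move: ba; rewrite le_eqVlt => /predU1P[->//|ba].
by apply/ltW/hxi => //; exact: zetaI.
Qed.

Lemma normal_fuzzy_comp xi u : increasing_homeo xi -> normal_fuzzy u ->
  normal_fuzzy (xi \o u).
Proof.
by move=> [hxi [zeta [[? ? ? ?] _]]]; exact: (@normal_fuzzy_homeo xi zeta).
Qed.

Lemma sup_dist_comp xi u v : increasing_homeo xi -> normal_fuzzy u ->
  normal_fuzzy v -> sup_dist (xi \o u) (xi \o v) = sup_dist u v.
Proof.
by move=> [hxi [zeta [[? ? ? ?] _]]]; exact: (@sup_dist_homeo xi zeta).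
Qed.

Lemma homeo_sup_leP xi e : increasing_homeo xi ->
  sup [set `|xi a - a| | a in `[0, 1]] <= e <->
  (forall a, 0 <= a <= 1 -> `|xi a - a| <= e).
Proof.
move=> [hxi [zeta [[xiI _ _ _] _]]]; split=> [h a aI|h].
  apply: le_trans h; apply: ub_le_sup; last by exists a => //=; rewrite in_itv.
  exists 1 => _ [b /= bI <-]; have := xiI _ bI; move: bI; rewrite /= !in_itv/=.
  move=> /andP[b0 b1] /andP[x0 x1]; rewrite ler_norml lerBlDr lerBrDr.
  by rewrite (le_trans x1) ?lerDl// (le_trans _ x0)// addrC subr_le0.
apply: ge_sup; first by exists `|xi 0 - 0|, 0 => //=; rewrite in_itv/= lexx ler01.
by move=> _ [a /= aI <-]; apply: h; rewrite in_itv in aI.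
Qed.

Definition skorokhod_close e u v := exists xi : R -> R,
  [/\ increasing_homeo xi, (forall a, 0 <= a <= 1 -> `|xi a - a| <= e) &
      sup_dist u (xi \o v) <= e].

Lemma skorokhod_distE u v :
  skorokhod_dist u v = inf [set e | skorokhod_close e u v].
Proof.
by congr inf; apply/seteqP; split => e [xi [hxi h1 h2]]; exists xi; split => //;
  apply/(homeo_sup_leP e hxi).
Qed.

Lemma skorokhod_close_ge0 e u v : skorokhod_close e u v -> 0 <= e.
Proof.
move=> [xi [_ /(_ 0) h _]]; apply: le_trans (h _) => //.
by rewrite lexx ler01.
Qed.

Lemma skorokhod_close_sup u v : normal_fuzzy u -> normal_fuzzy v ->
  skorokhod_close (sup_dist u v) u v.
Proof.
move=> fu fv; exists idfun; split => //; first exact: increasing_homeo_id.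
by move=> a _; rewrite subrr normr0 sup_dist_ge0.
Qed.

Lemma skorokhod_dist_le e u v : skorokhod_close e u v -> skorokhod_dist u v <= e.
Proof.
move=> h; rewrite skorokhod_distE; apply: ge_inf => //.
by exists 0 => e' /skorokhod_close_ge0.
Qed.

Lemma skorokhod_dist_lt e u v : normal_fuzzy u -> normal_fuzzy v ->
  skorokhod_dist u v < e -> exists2 e', skorokhod_close e' u v & e' < e.
Proof.
move=> fu fv; rewrite skorokhod_distE => /inf_lt[]; last by move=> e'; exists e'.
by exists (sup_dist u v); exact: skorokhod_close_sup.
Qed.

Lemma skorokhod_close_le e e' u v : e <= e' ->
  skorokhod_close e u v -> skorokhod_close e' u v.
Proof.
move=> ee' [xi [hxi h1 h2]]; exists xi; split=> //; last exact: le_trans ee'.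
by move=> a /h1 /le_trans; exact.
Qed.

Lemma skorokhod_dist_ge0 u v : normal_fuzzy u -> normal_fuzzy v ->
  0 <= skorokhod_dist u v.
Proof.
move=> fu fv; rewrite skorokhod_distE; apply: lb_le_inf.
  by exists (sup_dist u v); exact: skorokhod_close_sup.
by move=> e /skorokhod_close_ge0.
Qed.

Lemma skorokhod_distxx u : normal_fuzzy u -> skorokhod_dist u u = 0.
Proof.
move=> fu; apply/eqP; rewrite eq_le skorokhod_dist_ge0// andbT.
by rewrite -(sup_distxx fu); apply/skorokhod_dist_le/skorokhod_close_sup.
Qed.

Lemma skorokhod_close_sym e u v : normal_fuzzy u -> normal_fuzzy v ->
  skorokhod_close e u v -> skorokhod_close e v u.
Proof.
move=> fu fv [xi [hxi h1 h2]].
have [zeta hzeta [xiI zetaI xiK zetaK]] := increasing_homeo_inv hxi.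
exists zeta; split => //.
  move=> a aI; have aI' : a \in `[0, 1] by rewrite in_itv.
  rewrite -[X in _ - X](zetaK a)// distrC; apply: h1.
  by have := zetaI _ aI'; rewrite /= in_itv.
have -> : v = zeta \o (xi \o v).
  by apply/funext => x /=; rewrite xiK// in_itv/=; case: fv.
rewrite sup_dist_comp//; last exact: normal_fuzzy_comp.
by rewrite sup_distC.
Qed.

Lemma skorokhod_distC u v : normal_fuzzy u -> normal_fuzzy v ->
  skorokhod_dist u v = skorokhod_dist v u.
Proof.
move=> fu fv; rewrite !skorokhod_distE; congr inf.
by apply/seteqP; split => e; exact: skorokhod_close_sym.
Qed.

Lemma skorokhod_close_trans v u w e e' :
  normal_fuzzy u -> normal_fuzzy v -> normal_fuzzy w ->
  skorokhod_close e u v -> skorokhod_close e' v w ->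
  skorokhod_close (e + e') u w.
Proof.
move=> fu fv fw [xi [hxi xi1 xi2]] [eta [heta eta1 eta2]].
exists (xi \o eta); split; first exact: increasing_homeo_comp.
  move=> a aI /=; rewrite -[xi _](subrK (eta a)) -addrA.
  apply: le_trans (ler_normD _ _) _; apply: lerD; last exact: eta1.
  apply: xi1; have [_ [_ [[etaI _ _ _] _]]] := heta.
  by have := etaI a; rewrite /= !in_itv/=; exact.
apply: le_trans (sup_dist_triangle (v := xi \o v) fu _ _) _.
- exact: normal_fuzzy_comp.
- by apply: normal_fuzzy_comp => //; exact: increasing_homeo_comp.
- apply: lerD => //.
  rewrite (_ : (xi \o eta) \o w = xi \o (eta \o w))// sup_dist_comp//.
  exact: normal_fuzzy_comp.
Qed.

Lemma skorokhod_dist_triangle v u w :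
  normal_fuzzy u -> normal_fuzzy v -> normal_fuzzy w ->
  skorokhod_dist u w <= skorokhod_dist u v + skorokhod_dist v w.
Proof.
move=> fu fv fw; apply/ler_addgt0Pr => e e0; rewrite [e]splitr addrACA.
have [|e1 h1 /ltW le1] := @skorokhod_dist_lt (skorokhod_dist u v + e / 2) u v fu fv.
  by rewrite ltrDl divr_gt0.
have [|e2 h2 /ltW le2] := @skorokhod_dist_lt (skorokhod_dist v w + e / 2) v w fv fw.
  by rewrite ltrDl divr_gt0.
apply: le_trans (lerD le1 le2); apply: skorokhod_dist_le.
exact: skorokhod_close_trans h1 h2.
Qed.

Lemma skorokhod_close_fun_le u v : normal_fuzzy u -> normal_fuzzy v ->
  (forall e, 0 < e -> skorokhod_close e u v) -> forall x, u x <= v x.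
Proof.
move=> fu fv h x; have [u01 _ _ _] := fu; have [v01 ucv _ _] := fv.
rewrite leNgt; apply/negP => vu.
set a := u x; pose b := (v x + a) / 2.
have vb : v x < b by rewrite midf_lt.
have ba : b < a by rewrite midf_lt.
have aI : 0 <= a <= 1 by exact: u01.
have a0 : 0 < a by apply: le_lt_trans vu; have /andP[] := v01 x.
have /nbhs_ballP[r r0 hr] := ucv _ _ vb.
pose e := Num.min (r / 2) ((a - b) / 2).
have e0 : 0 < e by rewrite lt_min !divr_gt0// subr_gt0.
have [xi [hxi h1 h2]] := h e e0.
have fxv := normal_fuzzy_comp hxi fv.
have [[cu _] [_ xv0]] := (level_ncompact fu aI, level_ncompact fxv aI).
have [y] : exists2 y, level (xi \o v) a y & mdist x y < r.
  apply: dist_set_lt => //.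
  apply: le_lt_trans (dist_set_le_hausdorff cu xv0 _) _.
    by rewrite level_pos//= /a.
  apply: le_lt_trans (sup_dist_ge fu fxv aI) _.
  apply: le_lt_trans h2 _; rewrite gt_min; apply/orP; left.
  by rewrite ltr_pdivrMr// ltr_pMr// ltr1n.
rewrite level_pos//= => axy xy.
have vyb : v y < b by apply: hr; rewrite ballEmdist.
have := h1 _ (v01 y); apply/negP; rewrite -ltNge.
apply: lt_le_trans (ler_norm _).
apply: le_lt_trans (_ : (a - b) / 2 < _); first by rewrite ge_min lexx orbT.
apply: lt_trans (_ : a - b < _).
  by rewrite ltr_pdivrMr ?ltr_pMr ?subr_gt0 ?ltr1n.
by apply: le_lt_trans (_ : xi (v y) - b < _); [rewrite lerD2r|rewrite ltrD2l ltrN2].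
Qed.

Lemma skorokhod_close_eq u v : normal_fuzzy u -> normal_fuzzy v ->
  (forall e, 0 < e -> skorokhod_close e u v) -> u = v.
Proof.
move=> fu fv h; apply/funext => x; apply/eqP; rewrite eq_le.
rewrite skorokhod_close_fun_le//= skorokhod_close_fun_le// => e /h.
exact: skorokhod_close_sym.
Qed.

Lemma skorokhod_dist_eq0 u v : normal_fuzzy u -> normal_fuzzy v ->
  skorokhod_dist u v = 0 -> u = v.
Proof.
move=> fu fv uv0; apply: skorokhod_close_eq => // e e0.
have [|e' h /ltW] := @skorokhod_dist_lt e u v fu fv; first by rewrite uv0.
by move=> /skorokhod_close_le; exact.
Qed.

Lemma sup_dist_eq0 u v : normal_fuzzy u -> normal_fuzzy v ->
  sup_dist u v = 0 -> u = v.
Proof.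
move=> fu fv uv0; apply: skorokhod_close_eq => // e e0.
by apply: skorokhod_close_le (skorokhod_close_sup fu fv); rewrite uv0 ltW.
Qed.

Variables (f : X -> X) (cf : continuous f).

Lemma zadeh_fun_le1 u x : normal_fuzzy u -> 0 <= zadeh_fun f u x <= 1.
Proof.
move=> [u01 _ _ _]; rewrite /zadeh_fun; case: asboolP => [[y fy]|_]; last first.
  by rewrite lexx ler01.
apply/andP; split; last first.
  apply: ge_sup; first by exists (u y), y.
  by move=> _ [z _ <-]; have /andP[] := u01 z.
have /andP[uy0 _] := u01 y; apply: le_trans uy0 _; apply: ub_le_sup.
  by exists 1 => _ [z _ <-]; have /andP[] := u01 z.
by exists y.
Qed.

Lemma zadeh_fun_ge u y : normal_fuzzy u -> u y <= zadeh_fun f u (f y).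
Proof.
move=> [u01 _ _ _]; rewrite /zadeh_fun; case: asboolP; last by case; exists y.
move=> _; apply: ub_le_sup; last by exists y.
by exists 1 => _ [z _ <-]; have /andP[] := u01 z.
Qed.

Lemma zadeh_fun_attained u x : normal_fuzzy u -> 0 < zadeh_fun f u x ->
  exists2 y, f y = x & zadeh_fun f u x <= u y.
Proof.
move=> fu z0; have [u01 ucu cu0 _] := fu; set a := zadeh_fun f u x.
apply: contrapT => /forall2NP na.
have {}na y : f y = x -> u y < a.
  by move=> fy; have [//|/negP] := na y; rewrite -ltNge.
pose K := level u 0 `&` f @^-1` [set x].
have cK : compact K.
  apply: compact_closedI => //; apply: preimage_closed => //.
  exact/accessible_closed_set1/hausdorff_accessible/metric_hausdorff.
have : \forall b \near a^'-, K `<=` (fun y => u y < b).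
  move/compact_near_coveringP : cK; apply => y [_ fy].
  have [uyc ca] := midf_lt (na y fy); set c := (_ / _) in uyc ca.
  exists ([set y' | u y' < c], [set b | c < b]) => /=.
    by split; [exact: ucu|exact: nbhs_left_gt].
  by move=> [y' b] /= [h1 h2]; exact: lt_trans h2.
move=> hb.
have [b [[Kb b0] ba]] : exists b, (K `<=` (fun y => u y < b) /\ 0 < b) /\ b < a.
  have : \forall b \near a^'-, (K `<=` (fun y => u y < b) /\ 0 < b) /\ b < a.
    near=> b; split; last by near: b; exact: nbhs_left_lt.
    by split; near: b => //; exact: nbhs_left_gt.
  by move=> /filter_ex.
move: ba; rewrite ltNge => /negP; apply; rewrite /a /zadeh_fun.
case: asboolP => [[y fy]|_]; last exact: ltW.
apply: ge_sup; first by exists (u y), y.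
move=> _ [z fz <-]; rewrite leNgt; apply/negP => bz.
have : u z < b.
  apply: Kb; split => //; rewrite level0; apply: subset_closure => /=.
  exact: lt_trans bz.
by rewrite ltNge ltW.
Unshelve. all: by end_near. Qed.

Lemma zadeh_fun_ge_image u a : normal_fuzzy u -> 0 < a ->
  [set x | a <= zadeh_fun f u x] = f @` [set x | a <= u x].
Proof.
move=> fu a0; apply/seteqP; split => [x /= ax|_ [y /= ay <-]]; last first.
  exact: le_trans ay (zadeh_fun_ge y fu).
have [|y fy h] := zadeh_fun_attained fu (x := x); first exact: lt_le_trans ax.
by exists y => //=; exact: le_trans h.
Qed.

Lemma level_zadeh_fun u a : normal_fuzzy u -> 0 <= a <= 1 ->
  level (zadeh_fun f u) a = f @` level u a.
Proof.
move=> fu /andP[]; rewrite le_eqVlt => /predU1P[<- _|a0 _]; last first.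
  by rewrite !level_pos// zadeh_fun_ge_image.
have [u01 ucu cu0 _] := fu; have cfu : compact (f @` level u 0).
  by apply: continuous_compact => //; exact: continuous_subspaceT.
rewrite !level0 in cfu *; apply/seteqP; split => [|_ [y hy <-]].
  rewrite [X in _ `<=` X](closure_id _).1; last first.
    by apply: compact_closed => //; exact: metric_hausdorff.
  apply: closureS => x /= x0.
  have [y fy h] := zadeh_fun_attained fu x0.
  by exists y => //; apply: subset_closure => /=; exact: lt_le_trans h.
move=> B /cf /hy[z [/= z0 Bz]]; exists (f z); split => //=.
exact: lt_le_trans z0 (zadeh_fun_ge z fu).
Qed.

Lemma normal_fuzzy_zadeh u : normal_fuzzy u -> normal_fuzzy (zadeh_fun f u).
Proof.
move=> fu; have I0 : 0 <= (0 : R) <= 1 by rewrite lexx ler01.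
have I1 : 0 <= (1 : R) <= 1 by rewrite lexx ler01.
have cfu a : 0 <= a <= 1 -> compact (f @` level u a).
  move=> aI; apply: continuous_compact; first exact: continuous_subspaceT.
  by have [] := level_ncompact fu aI.
split; first by move=> x; exact: zadeh_fun_le1.
- apply/usc_closed => a; have [a0|a0] := leP a 0.
    rewrite (_ : mkset _ = setT); first exact: closedT.
    apply/seteqP; split => // x _ /=; rewrite (le_trans a0)//.
    by have /andP[] := zadeh_fun_le1 x fu.
  have [a1|a1] := leP a 1; last first.
    rewrite (_ : mkset _ = set0); first exact: closed0.
    apply/seteqP; split => // x /=; have /andP[_ h] := zadeh_fun_le1 x fu.
    by move=> /(lt_le_trans a1); rewrite ltNge h.
  rewrite zadeh_fun_ge_image// -level_pos//; apply: compact_closed.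
    exact: metric_hausdorff.
  by apply: cfu; rewrite ltW.
- by rewrite level_zadeh_fun//; exact: cfu.
- rewrite level_zadeh_fun//; have [_ [x ux]] := level_ncompact fu I1.
  by exists (f x), x.
Qed.

End Fuzzy_theory.

Section Fuzzy_spaces.
Context {R : realType}.

Record fuzzy (X : metricType R) := Fuzzy {
  fuzzy_fun :> X -> R ;
  fuzzyP : normal_fuzzy fuzzy_fun }.

Definition zadeh (X : metricType R) (f : X -> X) (cf : continuous f)
    (u : fuzzy X) : fuzzy X :=
  Fuzzy (normal_fuzzy_zadeh cf (fuzzyP u)).

(* Copies of the same type, so that each can carry its own metric. *)
Definition fuzzy_sup (X : metricType R) : Type := fuzzy X.
Definition fuzzy_skorokhod (X : metricType R) : Type := fuzzy X.

Variable X : metricType R.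

Lemma fuzzy_inj : injective (@fuzzy_fun X).
Proof.
move=> [u fu] [v fv] /= uv; rewrite -{}uv in fv *.
by rewrite (Prop_irrelevance fu fv).
Qed.

HB.instance Definition _ := gen_eqMixin (fuzzy_sup X).
HB.instance Definition _ := gen_choiceMixin (fuzzy_sup X).
HB.instance Definition _ := @isMetric.Build R (fuzzy_sup X)
  (fun u v : fuzzy X => sup_dist u v)
  (fun u : fuzzy X => sup_distxx (fuzzyP u))
  (fun (u v : fuzzy X) uv0 =>
    fuzzy_inj (sup_dist_eq0 (fuzzyP u) (fuzzyP v) uv0))
  (fun u v : fuzzy X => sup_distC u v)
  (fun v u w : fuzzy X =>
    sup_dist_triangle (fuzzyP u) (fuzzyP v) (fuzzyP w)).

HB.instance Definition _ := gen_eqMixin (fuzzy_skorokhod X).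
HB.instance Definition _ := gen_choiceMixin (fuzzy_skorokhod X).
HB.instance Definition _ := @isMetric.Build R (fuzzy_skorokhod X)
  (fun u v : fuzzy X => skorokhod_dist u v)
  (fun u : fuzzy X => skorokhod_distxx (fuzzyP u))
  (fun (u v : fuzzy X) uv0 =>
    fuzzy_inj (skorokhod_dist_eq0 (fuzzyP u) (fuzzyP v) uv0))
  (fun u v : fuzzy X => skorokhod_distC (fuzzyP u) (fuzzyP v))
  (fun v u w : fuzzy X =>
    skorokhod_dist_triangle (fuzzyP u) (fuzzyP v) (fuzzyP w)).

End Fuzzy_spaces.

(* Main.v *)
Require Import Defs.
From mathcomp Require Import all_boot all_order all_algebra.
From mathcomp Require Import all_classical all_reals all_analysis.
From mathcomp Require Import ring lra.

Set Implicit Arguments.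
Unset Strict Implicit.
Unset Printing Implicit Defensive.

Import Order.TTheory GRing.Theory Num.Theory.
Import numFieldTopology.Exports.

Local Open Scope classical_set_scope.
Local Open Scope ring_scope.

(* Recurrence of all products [f_(N)] means that any finite family of nonempty
   open sets has its return sets meeting in a member of [A] (joint recurrence).
   Finite subsets of [X] are dense in [K(X)], and fuzzy sets with finite support
   are dense in [F_oo(X)], so joint recurrence passes to both spaces: move each
   point of a finite approximation to a point that returns.
   Conversely, the identity [F_oo(X) -> F_0(X)] and the core map [u |-> u_1] from
   [F_0(X)] to [K(X)] are continuous surjections commuting with the dynamics, so
   recurrence descends along them to [K(X)]; there, joint recurrence is recovered
   by shrinking a family until no orbit leads from one member to another. *)

(** * Return sets, factor maps and boxes in finite powers *)

Section Return_sets.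
Context {Y : Type}.
Implicit Types (g : Y -> Y) (U V : set Y).

Lemma return_setP l g U n : return_set l g U n <->
  exists y, forall i, (i <= l)%N -> U (iter (i * n)%N g y).
Proof. by split=> -[y hy]; exists y => i; have := hy i. Qed.

Lemma return_setS l g U V : U `<=` V -> return_set l g U `<=` return_set l g V.
Proof. by move=> UV n [y hy]; exists y => i /hy /UV. Qed.

(** The point [iter m g y] is the witness, since iterates of [g] commute. One set thus accounts for
    the returns of two. *)
Lemma return_set_shift l g U V m n :
  return_set l g (U `&` iter m g @^-1` V) n -> return_set l g V n.
Proof.
move=> [y hy]; exists (iter m g y) => i /hy[_] /=.
by rewrite -!iterD addnC.
Qed.

End Return_sets.

Lemma continuous_iter (Y : topologicalType) (g : Y -> Y) n :
  continuous g -> continuous (iter n g).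
Proof.
move=> cg; elim: n => [|n IHn] y; first exact: cvg_id.
exact: (continuous_comp (IHn y) (cg _)).
Qed.

Lemma topologically_recurrent_factor (Y Z : topologicalType) l
    (A : set (set nat)) (g : Y -> Y) (h : Z -> Z) (p : Y -> Z) :
  furstenberg_family A -> continuous p -> set_surj setT setT p ->
  (forall y, p (g y) = h (p y)) ->
  topologically_recurrent l A g -> topologically_recurrent l A h.
Proof.
move=> [Aup _] cp sp pgh rg U oU [z Uz].
have pgi n y : p (iter n g y) = iter n h (p y).
  by elim: n => //= n IHn; rewrite pgh IHn.
have [y _ yz] := sp z I.
apply: Aup (rg (p @^-1` U) _ _) _.
- by move/continuousP: cp; exact.
- by exists y; rewrite /= yz.
- by move=> n [w hw]; exists (p w) => i /hw /=; rewrite pgi.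
Qed.

(** A box in a power of [Y], stored as a list so that families can be shortened by induction. The
    empty list is excluded: its joint return set is all of [nat], which is missing from [A] when [A]
    is empty. *)
Definition jointly_recurrent (Y : topologicalType) l (A : set (set nat))
    (g : Y -> Y) : Prop :=
  forall s : seq (set Y), s != [::] ->
    (forall U, U \in s -> open U /\ U !=set0) ->
    A [set n | forall U, U \in s -> return_set l g U n].

(** Boxes around [y] generate a filter. It converges to [y] in each coordinate, hence for the
    supremum of the coordinate topologies. *)
Lemma nbhs_ptws_box (I : finType) (Y : topologicalType)
    (y : {ptws I -> Y}) (W : set {ptws I -> Y}) : nbhs y W ->
  exists2 B : I -> set Y, (forall i, open (B i) /\ B i (y i)) &
    [set z | forall i, B i (z i)] `<=` W.
Proof.
pose D := [set B : I -> set Y | forall i, open (B i) /\ B i (y i)].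
pose F : set_system {ptws I -> Y} :=
  filter_from D (fun B => [set z | forall i, B i (z i)]).
have FF : Filter F.
  apply: filter_from_filter; first by exists (fun=> setT) => i; split => //; exact: openT.
  move=> B C DB DC; exists (fun i => B i `&` C i).
    by move=> i; have [? ?] := DB i; have [? ?] := DC i; split => //; exact: openI.
  by move=> z hz; split=> i; have [] := hz i.
suff /(_ W) h : F --> y by move=> /h[B DB BW]; exists B.
apply/cvg_sup => i.
move=> S [_ [[V oV <-] /= Vy VS]].
exists (fun j => if j == i then V else setT).
  by move=> j; case: eqP => [->|_]; split => //; exact: openT.
by move=> z /(_ i); rewrite eqxx => /VS.
Qed.

Lemma open_ptws_box (I : finType) (Y : topologicalType) (B : I -> set Y) :
  (forall i, open (B i)) -> open [set z : {ptws I -> Y} | forall i, B i (z i)].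
Proof.
move=> oB; rewrite openE => z hz; apply: (@filter_forall _ _ (fun i => @proj I (fun=> Y) i @^-1` B i) (nbhs z)) => i.
apply: (@proj_continuous I (fun=> Y) i z).
by apply: open_nbhs_nbhs; split; [exact: oB|exact: hz].
Qed.

(** * Joint recurrence versus recurrence on powers and on the hyperspace *)

Section Product_hyperspace.
Context {X : topologicalType} (l : nat) (A : set (set nat)) (f : X -> X).
Hypothesis hA : furstenberg_family A.

Lemma iter_fold_product N n (y : {ptws 'I_N -> X}) i :
  iter n (fold_product f) y i = iter n f (y i).
Proof. by elim: n y => // n IHn y; rewrite !iterSr IHn. Qed.

Lemma fold_product_jointly_recurrent :
  (forall N, (0 < N)%N ->
    @topologically_recurrent {ptws 'I_N -> X} l A (fold_product f)) ->
  jointly_recurrent l A f.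
Proof.
move=> rf s s0 hs; have [Aup _] := hA.
pose B (i : 'I_(size s)) := nth set0 s i.
have hB i : open (B i) /\ B i !=set0 by apply/hs/mem_nth.
apply: Aup (rf (size s) _ [set z | forall i, B i (z i)] _ _) _.
- by rewrite lt0n size_eq0.
- by apply: open_ptws_box => i; have [] := hB i.
- by have [y yB] := choice (fun i => (hB i).2); exists y.
move=> n [z hz] U Us; have ltU : (index U s < size s)%N by rewrite index_mem.
exists (z (Ordinal ltU)) => i /hz /(_ (Ordinal ltU)).
by rewrite /B /= nth_index// iter_fold_product.
Qed.

Lemma jointly_recurrent_fold_product :
  jointly_recurrent l A f -> forall N, (0 < N)%N ->
    @topologically_recurrent {ptws 'I_N -> X} l A (fold_product f).
Proof.
move=> rf [//|N] _ W oW [y Wy]; have [Aup _] := hA.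
have [|B hB BW] := @nbhs_ptws_box _ _ y W.
  by apply: open_nbhs_nbhs; split.
apply: Aup (rf [seq B i | i <- enum 'I_N.+1] _ _) _.
- by rewrite -size_eq0 size_map size_enum_ord.
- by move=> _ /mapP[i _ ->]; have [? ?] := hB i; split => //; exists (y i).
move=> n hn.
have /choice[z hz] (i : 'I_N.+1) : exists x, forall k, (k <= l)%N ->
    B i (iter (k * n) f x).
  by apply/return_setP/hn/map_f; rewrite mem_enum.
exists z => k kl; apply: BW => i /=; rewrite iter_fold_product; exact: hz.
Qed.

Hypothesis cf : continuous f.

Lemma iter_hyper_map n (K : hyperspace X) :
  (iter n (hyper_map cf) K : set X) = iter n f @` K.
Proof.
elim: n => [|n IHn] /=; first by rewrite image_id.
by rewrite IHn image_comp.
Qed.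

Lemma open_vietoris (s : seq (set X)) : s != [::] ->
  (forall U, U \in s -> open U /\ U !=set0) ->
  open (vietoris (size s, nth set0 s)).
Proof.
move=> s0 hs; exists [set (size s, nth set0 s)]; last by rewrite bigcup_set1.
move=> _ ->; split => /=; first by rewrite lt0n size_eq0.
by move=> j js; exact/hs/mem_nth.
Qed.

(** One returning point is chosen in each set of a basic Vietoris set, all for the same time [n].
    These finitely many points form a compact set that returns. *)
Lemma jointly_recurrent_hyper_map :
  jointly_recurrent l A f -> topologically_recurrent l A (hyper_map cf).
Proof.
move=> rf W oW; have [Aup _] := hA.
have [D sD <-] : exists2 D, D `<=` @vietoris_index X &
  \bigcup_(NU in D) vietoris NU = W := oW.
move=> [K [[N U] DNU [/= KU1 KU2]]].
have [/= N0 hU] := sD _ DNU.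
apply: Aup (rf [seq U i | i <- iota 0 N] _ _) _.
- by rewrite -size_eq0 size_map size_iota -lt0n.
- by move=> _ /mapP[i + ->]; rewrite mem_iota add0n => /hU.
move=> n hn.
have /choice[z hz] (i : 'I_N) : exists x, forall k, (k <= l)%N ->
    U i (iter (k * n) f x).
  by apply/return_setP/hn/map_f; rewrite mem_iota add0n ltn_ord.
have L_ncompact : compact (range z) /\ range z !=set0.
  split; last by exists (z (Ordinal N0)), (Ordinal N0).
  exact/finite_compact/finite_image/finite_finset.
exists (Hyperspace L_ncompact) => k kl; exists (N, U) => //=.
split=> [|j jN]; rewrite /= iter_hyper_map.
  by move=> _ [_ [i _ <-] <-]; exists i => //=; exact: hz.
exists (iter (k * n) f (z (Ordinal jN))); split; last exact: (hz (Ordinal jN)).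
by exists (z (Ordinal jN)) => //; exists (Ordinal jN).
Qed.

(* If some iterate of [U] meets another member [V], recurrence of
   [U `&` iter m f @^-1` V] yields that of both, so the family can be shortened.
   Otherwise orbits starting in a member can only return to that same member,
   and the Vietoris set of the family already separates them. *)
Lemma hyper_map_jointly_recurrent :
  topologically_recurrent l A (hyper_map cf) -> jointly_recurrent l A f.
Proof.
move=> rf s; have [m] := ubnP (size s); elim: m s => // m IHm s sm s0 hs.
have [Aup _] := hA.
have [[U [V [k [Us Vs UV [x [Ux Vx]]]]]]|sep] := pselect (exists U V k,
    [/\ U \in s, V \in s, U != V & U `&` iter k f @^-1` V !=set0]).
  have VsU : V \in rem U s by move: Vs; rewrite (perm_mem (perm_to_rem Us)) inE
    eq_sym (negbTE UV).
  (* [U] and [V] are replaced by a single set, so the list loses one entry. *)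
  apply: Aup (IHm (U `&` iter k f @^-1` V :: rem V (rem U s)) _ _ _) _ => //.
  - have : (0 < size (rem U s))%N by case: (rem U s) VsU.
    rewrite /= !size_rem//.
    by case: (size s) sm => [|[|k']]; rewrite ?ltnS.
  - move=> W; rewrite inE => /predU1P[->|/mem_rem/mem_rem/hs//].
    split; last by exists x.
    apply: openI; first by have [] := hs _ Us.
    have [oV _] := hs _ Vs.
    by move/continuousP: (@continuous_iter _ _ k cf); exact.
  move=> n hn W; rewrite (perm_mem (perm_to_rem Us)) inE.
  rewrite (perm_mem (perm_to_rem VsU)) inE => /or3P[/eqP->|/eqP->|Ws].
  - by apply: return_setS (hn _ (mem_head _ _)) => y [].
  - exact: return_set_shift (hn _ (mem_head _ _)).
  - by apply: hn; rewrite inE Ws orbT.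
have /choice[y hy] (i : 'I_(size s)) : exists x, nth set0 s i x.
  by have [] := hs _ (mem_nth set0 (ltn_ord i)).
have L_ncompact : compact (range y) /\ range y !=set0.
  have s_gt0 : (0 < size s)%N by rewrite lt0n size_eq0.
  split; last by exists (y (Ordinal s_gt0)), (Ordinal s_gt0).
  exact/finite_compact/finite_image/finite_finset.
apply: Aup (rf _ (open_vietoris s0 hs) _) _.
  exists (Hyperspace L_ncompact); split => /=.
    by move=> _ [i _ <-]; exists i => /=.
  by move=> j js; exists (y (Ordinal js)); split;
    [exists (Ordinal js)|exact: (hy (Ordinal js))].
move=> n /return_setP[K hK] U Us.
(* The case [i = 0] gives a point [x] of [K] itself in [U]. Its later iterates stay in the union of
   the family, and [sep] rules out every member but [U]. *)
have [/= _ KU] := hK 0 (leq0n _).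
have [x []] := KU (index U s) (etrans (index_mem _ _) Us).
rewrite nth_index// => Kx Ux; exists x => i il.
have [/= + _] := hK i il; rewrite iter_hyper_map => /(_ (iter (i * n) f x)).
case; first by exists x.
move=> j js; have [->//|jU] := eqVneq (nth set0 s j) U.
move=> Vx; exfalso; apply: sep; exists U, (nth set0 s j), (i * n)%N.
by split; [|exact: mem_nth|rewrite eq_sym|exists x].
Qed.

End Product_hyperspace.

(** A finite subcover that remembers its witnesses: compactness is used along the filter of lists
    ordered by inclusion. *)
Lemma compact_finite_witness (T : topologicalType) (I : eqType) (K : set T)
    (P : I -> T -> Prop) : compact K ->
  (forall x, K x -> exists i, \forall y \near x, P i y) ->
  exists s : seq I, forall y, K y -> exists2 i, i \in s & P i y.
Proof.
move=> /compact_near_coveringP cK hP.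
pose F : set_system (seq I) :=
  filter_from setT (fun t : seq I => [set s : seq I | {subset t <= s}]).
have FF : Filter F.
  apply: filter_from_filter; first by exists [::].
  move=> t t' _ _; exists (t ++ t') => // s /= ts.
  by split => i it; apply: ts; rewrite mem_cat it ?orbT.
have [|s _ hs] := cK _ F (fun (s : seq I) y => exists2 i, i \in s & P i y) FF.
  move=> x /hP[i Pi]; exists (P i, [set s : seq I | i \in s]) => /=.
    split => //; exists [:: i] => // s; apply; exact: mem_head.
  by move=> [y s] [] /= Piy si; exists i.
by exists s; apply: hs => i.
Qed.

(** * Construction of fuzzy sets from their levels, and finite nets *)

Section Fuzzy_levels.
Context {R : realType} {X : metricType R}.
Implicit Types (u v : X -> R) (K L : set X).

(** Without a maximum, each point of [K] lies near points strictly below some [u p]. Finitely many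
    such [p] suffice, and the best of them contradicts this. *)
Lemma usc_compact_max u K : upper_semicontinuous u -> ncompact K ->
  exists2 p, K p & forall y, K y -> u y <= u p.
Proof.
move=> ucu [cK [y0 Ky0]]; apply: contrapT => /forall2NP nmax.
have [|s hs] :=
    @compact_finite_witness _ X K (fun p y => K p /\ u y < u p) cK.
  move=> x Kx; have [//|/existsNP[p /not_implyP[Kp /negP]]] := nmax x.
  rewrite -ltNge => xp; exists p; apply: filterS (ucu _ _ xp) => y yp.
  by split.
(* The list may contain points outside [K]; they are skipped, and [y0] is the starting value. *)
have [y Ky ymax] : exists2 y, K y & forall p, p \in s -> K p -> u p <= u y.
  elim: s {hs} => [|q s [y Ky ymax]]; first by exists y0.
  have [[Kq yq]|nq] := pselect (K q /\ u y < u q).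
    exists q => // p; rewrite inE => /predU1P[->//|ps Kp].
    exact: le_trans (ymax _ ps Kp) (ltW yq).
  exists y => // p; rewrite inE => /predU1P[-> Kq|]; last exact: ymax.
  by rewrite leNgt; apply/negP => yq; apply: nq.
by have [p ps [Kp]] := hs y Ky; rewrite ltNge ymax.
Qed.

Lemma normal_fuzzy_compact_levels u : (forall x, 0 <= u x <= 1) ->
  (forall a, 0 <= a <= 1 -> compact (level u a)) -> level u 1 !=set0 ->
  normal_fuzzy u.
Proof.
move=> u01 cu u1; split => //; last by apply: cu; rewrite lexx ler01.
apply/usc_closed => a; have [a0|a0] := leP a 0.
  rewrite (_ : mkset _ = setT); first exact: closedT.
  apply/seteqP; split => // x _ /=; rewrite (le_trans a0)//.
  by have /andP[] := u01 x.
have [a1|a1] := leP a 1; last first.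
  rewrite (_ : mkset _ = set0); first exact: closed0.
  apply/seteqP; split => // x /=; have /andP[_ h] := u01 x.
  by move=> /(lt_le_trans a1); rewrite ltNge h.
rewrite -level_pos//; apply: compact_closed; first exact: metric_hausdorff.
by apply: cu; rewrite ltW.
Qed.

Lemma level_indic K a : compact K -> 0 <= a <= 1 -> level (\1_K) a = K :> set X.
Proof.
move=> cK /andP[]; rewrite le_eqVlt => /predU1P[<- _|a0 a1].
  rewrite level0 [RHS](closure_id _).1; last first.
    by apply: compact_closed => //; exact: metric_hausdorff.
  congr closure; apply/seteqP; split => x /=; rewrite indicE.
    by case: (boolP (x \in K)) => [/set_mem//|_]; rewrite ltxx.
  by move/mem_set => ->; exact: ltr01.
rewrite level_pos//; apply/seteqP; split => x /=; rewrite indicE.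
  by case: (boolP (x \in K)) => [/set_mem//|_]; rewrite leNgt a0.
by move/mem_set => ->.
Qed.

Lemma normal_fuzzy_indic K : ncompact K -> normal_fuzzy (\1_K : X -> R).
Proof.
move=> [cK K0]; apply: normal_fuzzy_compact_levels.
- by move=> x; rewrite indicE ler0n lern1; case: (x \in K).
- by move=> a aI; rewrite level_indic.
- by rewrite level_indic// lexx ler01.
Qed.

Section Finite_fuzzy.
Context {I : finType} (c : I -> R).
Implicit Type y : I -> X.

(** The push-forward of the weights [c] along [y], as in Zadeh's extension: where points coincide,
    the largest weight wins. *)
Definition finite_fuzzy y (x : X) : R := \big[Num.max/0]_(i | y i == x) c i.

Hypothesis c01 : forall i, 0 < c i <= 1.

Lemma finite_fuzzy_geP y x a : 0 < a ->
  a <= finite_fuzzy y x <-> exists2 i, y i = x & a <= c i.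
Proof.
move=> a0; split=> [/bigmax_geP[|[i /eqP]]|[i yi ai]].
- by rewrite leNgt a0.
- by exists i.
- by apply/bigmax_geP; right; exists i => //; apply/eqP.
Qed.

Lemma level_finite_fuzzy y a : 0 <= a <= 1 ->
  level (finite_fuzzy y) a = y @` [set i | a <= c i].
Proof.
move=> /andP[]; rewrite le_eqVlt => /predU1P[<- _|a0 a1]; last first.
  rewrite level_pos//; apply/seteqP; split => x /=.
    by move/(finite_fuzzy_geP _ _ a0) => [i yi ai]; exists i.
  by move=> [i ai yi]; apply/(finite_fuzzy_geP _ _ a0); exists i.
(* At level 0 every index counts because all weights are positive, and the finite range of [y] is
   already closed. *)
rewrite level0 [RHS](closure_id _).1; last first.
  apply: compact_closed; first exact: metric_hausdorff.
  exact/finite_compact/finite_image/finite_finset.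
congr closure; apply/seteqP; split => x /=.
  move=> x0; have [//|i yi ai] := (finite_fuzzy_geP y x x0).1.
  by exists i => //; exact: le_trans (ltW x0) ai.
move=> [i _ yi]; have /andP[ci _] := c01 i; apply: lt_le_trans ci _.
by apply/(finite_fuzzy_geP _ _ (proj1 (andP (c01 i)))); exists i.
Qed.

Lemma normal_finite_fuzzy y : (exists i, c i = 1) -> normal_fuzzy (finite_fuzzy y).
Proof.
move=> [i ci]; apply: normal_fuzzy_compact_levels.
- move=> x; rewrite bigmax_ge_id /=; apply/bigmax_leP; split => // j _.
  by have /andP[] := c01 j.
- move=> a aI; rewrite level_finite_fuzzy//.
  exact/finite_compact/finite_image/finite_finset.
- by rewrite level_finite_fuzzy ?lexx ?ler01//; exists (y i), i; rewrite //= ci.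
Qed.

End Finite_fuzzy.

(* Each point [p] is a maximum of [u] over a small closed ball, so it can stand
   for all the points of that ball at every level simultaneously. *)
Lemma normal_fuzzy_net u e : normal_fuzzy u -> 0 < e ->
  exists2 s : seq X, forall p, p \in s -> 0 < u p &
    forall x, level u 0 x -> exists2 p, p \in s & mdist x p < e /\ u x <= u p.
Proof.
move=> [u01 ucu cu0 u1] e0; have e3 : 0 < e / 3 by rewrite divr_gt0.
pose P p y := [/\ 0 < u p, mdist y p < e & level u 0 y -> u y <= u p].
have [x0 Kx0|s hs] := @compact_finite_witness _ X (level u 0) P cu0; last first.
  exists [seq p <- s | 0 < u p].
    by move=> p; rewrite mem_filter => /andP[].
  move=> x Kx; have [p ps [up xp uxp]] := hs x Kx; exists p; last by split => //; exact: uxp.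
  by rewrite mem_filter up.
(* The closure makes [B] compact. It costs one third of [e]: a point of the closure is only close to
   a point of the ball. *)
pose B := level u 0 `&` closure (ball x0 (e / 3)).
have nB : ncompact B.
  split; last by exists x0; split => //; apply: subset_closure; exact: ballxx.
  by apply: compact_closedI => //; exact: closed_closure.
have [p [Kp Bp] pmax] := usc_compact_max ucu nB.
(* [u x0] may vanish, since [x0] is only a limit of points where [u] is positive; such a point [z]
   in the ball bounds [u p] from below. *)
have u_gt0 : 0 < u p.
  move: Kx0; rewrite level0 => /(_ _ (nbhsx_ballx x0 _ e3))[z [/= uz x0z]].
  apply: (lt_le_trans uz); apply: pmax; split; last exact: subset_closure.
  by rewrite level0; exact: subset_closure.
exists p; apply: filterS (nbhsx_ballx x0 _ e3) => y x0y; split => //.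
  have [z [x0z pz]] := Bp _ (nbhsx_ballx p _ e3).
  suff : ball p e y by rewrite ballEmdist /= metric_sym.
  rewrite (_ : e = e / 3 + e / 3 + e / 3); last by field.
  exact: ball_triangle (ball_triangle pz (ball_sym x0z)) x0y.
by move=> Ky; apply: pmax; split => //; exact: subset_closure.
Qed.

End Fuzzy_levels.

(** * Hausdorff neighbourhoods, the core map, and recurrence of the Zadeh extension *)

Section Fuzzy_dynamics.
Context {R : realType} {X : metricType R}.

Lemma hausdorff_dist_lt (K L : set X) e x : ncompact K -> ncompact L ->
  hausdorff_dist K L < e -> K x -> exists2 y, L y & mdist x y < e.
Proof.
move=> [cK _] [_ L0] KLe Kx; apply: dist_set_lt => //.
exact: le_lt_trans (dist_set_le_hausdorff cK L0 Kx) KLe.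
Qed.

(** A Lebesgue number keeps nearby compact sets inside the union of the [U j]; a ball inside each
    [U j], centred in [K], makes them meet it. *)
Lemma nbhs_hyperspace_hausdorff (K : hyperspace X) (W : set (hyperspace X)) :
  open W -> W K -> exists2 e : R, 0 < e &
    forall L : hyperspace X, hausdorff_dist K L < e -> W L.
Proof.
move=> oW; have [D sD <-] : exists2 D, D `<=` @vietoris_index X &
  \bigcup_(NU in D) vietoris NU = W := oW.
move=> [[N U] DNU [/= KU1 KU2]]; have [/= N0 hU] := sD _ DNU.
have nK := hyperspaceP K; have [cK _] := nK.
pose V := \bigcup_(j in `I_N) U j.
have oV : open V by apply: bigcup_open => j /= /hU[].
have inV : \forall e \near 0^'+, forall x, (K : set X) x -> ball x e `<=` V.
  have := (@compact_near_coveringP X K).1 cK _ (0^'+ : set_system R)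
    (fun e x => ball x e `<=` V) _.
  apply => x Kx.
  have /nbhs_ballP[r r0 rV] := open_nbhs_nbhs (conj oV (KU1 _ Kx)).
  have r2 : 0 < r / 2 by rewrite divr_gt0.
  exists (ball x (r / 2), [set e | e < r / 2]) => /=.
    by split; [exact: nbhsx_ballx|exact: nbhs_right_lt].
  move=> [y e] /= [xy er] z yz; apply: rV.
  by apply: ball_split xy (le_ball (ltW er) yz).
have inU : \forall e \near (0 : R)^'+, forall j : 'I_N,
    exists2 x, (K : set X) x & ball x e `<=` U j.
  apply: (@filter_forall _ _
    (fun (j : 'I_N) e => exists2 x, (K : set X) x & ball x e `<=` U j) (0 : R)^'+).
  move=> j; have [x [Kx Ux]] := KU2 _ (ltn_ord j).
  have [oU _] := hU _ (ltn_ord j).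
  have /nbhs_ballP[r r0 rU] := open_nbhs_nbhs (conj oU Ux).
  near=> e; exists x => //; apply: subset_trans rU; apply: le_ball.
  by near: e; exact: nbhs_right_le.
have [e [[e0 eV] eU]] : exists e : R, (0 < e /\ forall x, (K : set X) x -> ball x e `<=` V) /\
    forall j : 'I_N, exists2 x, (K : set X) x & ball x e `<=` U j.
  have : \forall e \near (0 : R)^'+, (0 < e /\ forall x, (K : set X) x -> ball x e `<=` V) /\
    forall j : 'I_N, exists2 x, (K : set X) x & ball x e `<=` U j.
    near=> e; split; last by near: e.
    by split; near: e => //; exact: nbhs_right_gt.
  exact: filter_ex.
exists e => // L KL; exists (N, U) => //; have nL := hyperspaceP L.
split => [y Ly|j jN].
  have LK : hausdorff_dist L K < e by rewrite hausdorff_distC.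
  have [x Kx yx] := hausdorff_dist_lt nL nK LK Ly.
  by apply: (eV x Kx); rewrite ballEmdist/= metric_sym.
have [x Kx xU] := eU (Ordinal jN).
have [y Ly xy] := hausdorff_dist_lt nK nL KL Kx.
by exists y; split => //; apply: xU; rewrite ballEmdist.
Unshelve. all: by end_near. Qed.

(** Every reparametrisation fixes 1, so it leaves the core of [v] unchanged. *)
Lemma skorokhod_dist_core (u v : X -> R) : normal_fuzzy u -> normal_fuzzy v ->
  hausdorff_dist (level u 1) (level v 1) <= skorokhod_dist u v.
Proof.
move=> fu fv; apply/ler_addgt0Pr => e e0.
have [|e' [xi [hxi _ h]] /ltW ee'] :=
  @skorokhod_dist_lt _ _ (skorokhod_dist u v + e) u v fu fv; first by rewrite ltrDl.
apply: le_trans ee'; apply: le_trans h.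
have I1 : 0 <= (1 : R) <= 1 by rewrite lexx ler01.
have := sup_dist_ge fu (normal_fuzzy_comp hxi fv) I1.
have [hx [zeta [[? ? ? ?] _]]] := hxi.
by rewrite (@level_homeo _ _ xi zeta)// (@homeo_inv1 _ xi zeta).
Qed.

Lemma skorokhod_dist_le_sup (u v : X -> R) : normal_fuzzy u -> normal_fuzzy v ->
  skorokhod_dist u v <= sup_dist u v.
Proof. by move=> fu fv; exact/skorokhod_dist_le/skorokhod_close_sup. Qed.

Let I1 : 0 <= (1 : R) <= 1. Proof. by rewrite lexx ler01. Qed.

Definition fuzzy_core (u : fuzzy X) : hyperspace X :=
  Hyperspace (level_ncompact (fuzzyP u) I1).

Lemma continuous_fuzzy_core :
  continuous (fuzzy_core : fuzzy_skorokhod X -> hyperspace X).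
Proof.
apply/continuousP => W oW; rewrite openE => u Wu.
have [e e0 eW] := nbhs_hyperspace_hausdorff oW Wu.
apply/nbhs_ballP; exists e => //= v; rewrite ballEmdist /= => uv.
apply: eW; apply: le_lt_trans uv.
exact: skorokhod_dist_core (fuzzyP (u : fuzzy X)) (fuzzyP (v : fuzzy X)).
Qed.

Lemma continuous_fuzzy_id :
  continuous (id : fuzzy_sup X -> fuzzy_skorokhod X).
Proof.
move=> u W /nbhs_ballP[e e0 eW]; apply/nbhs_ballP; exists e => //= v uv.
apply: eW; move: uv; rewrite !ballEmdist /=; apply: le_lt_trans.
exact: skorokhod_dist_le_sup (fuzzyP (u : fuzzy X)) (fuzzyP (v : fuzzy X)).
Qed.

Lemma hyperspace_inj (K L : hyperspace X) : K = L :> set X -> K = L.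
Proof.
case: K L => [K hK] [L hL] /= KL; subst L; congr Hyperspace.
exact: Prop_irrelevance.
Qed.

(** The characteristic function of [K] has core [K]. *)
Lemma fuzzy_core_surj : set_surj setT setT fuzzy_core.
Proof.
move=> K _; have nK := hyperspaceP K.
exists (Fuzzy (normal_fuzzy_indic nK)) => //.
by apply/hyperspace_inj/level_indic => //; case: nK.
Qed.

Variables (l : nat) (A : set (set nat)) (f : X -> X) (cf : continuous f).
Hypothesis hA : furstenberg_family A.

Lemma fuzzy_core_zadeh u : fuzzy_core (zadeh cf u) = hyper_map cf (fuzzy_core u).
Proof.
by apply/hyperspace_inj/level_zadeh_fun => //; exact: fuzzyP.
Qed.

Lemma level_iter_zadeh n (u : fuzzy X) a : 0 <= a <= 1 ->
  level (iter n (zadeh cf) u) a = iter n f @` level u a.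
Proof.
move=> aI; elim: n => [|n IHn] /=; first by rewrite image_id.
rewrite level_zadeh_fun//; last exact: fuzzyP.
by rewrite IHn image_comp.
Qed.

(** The points of a finite net of [u] keep their weights but are moved to nearby returning points.
    The weights travel along the orbits, so all levels stay close to those of [u] at once. *)
Lemma jointly_recurrent_zadeh :
  jointly_recurrent l A f -> @topologically_recurrent (fuzzy_sup X) l A (zadeh cf).
Proof.
move=> rf W oW [w Ww]; have [Aup _] := hA.
have /nbhs_ballP[e /= e0 eW] := open_nbhs_nbhs (conj oW Ww).
pose u : fuzzy X := w; have fu := fuzzyP u; have e3 : 0 < e / 3 by rewrite divr_gt0.
have [s s_pos s_net] := normal_fuzzy_net fu e3.
have [u01 _ _ [x1 ux1]] := fu.
have I0 : 0 <= (0 : R) <= 1 by rewrite lexx ler01.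
have [p1 p1s [_ up1]] := s_net x1 (level1_sub I0 ux1).
apply: Aup (rf [seq (ball p (e / 3))° | p <- s] _ _) _.
- by rewrite -size_eq0 size_map; case: (s) p1s.
- move=> _ /mapP[p _ ->]; split; first exact: open_interior.
  by exists p; exact: nbhsx_ballx.
move=> n hn; pose t := tnth (in_tuple s); pose c i := u (t i).
have c01 i : 0 < c i <= 1.
  by rewrite s_pos ?mem_tnth//=; have /andP[] := u01 (t i).
have t_onto p : p \in s -> exists i, t i = p.
  by move=> /(tnthP (in_tuple s))[i ->]; exists i.
(* Normality: [p1] dominates the core point [x1], so its weight is 1. *)
have c1 : exists i, c i = 1.
  have [i ti] := t_onto _ p1s; exists i; apply/eqP; rewrite eq_le.
  have /andP[_ -> /=] := c01 i; rewrite /c ti; apply: le_trans up1.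
  by move: ux1; rewrite level_pos.
have /choice[y hy] i : exists x, forall k, (k <= l)%N ->
    (ball (t i) (e / 3))° (iter (k * n) f x).
  exact/return_setP/hn/map_f/mem_tnth.
pose v := Fuzzy (normal_finite_fuzzy c01 y c1).
exists v => k kl; apply: eW; rewrite ballEmdist /=.
(* A supremum over levels gives only a non-strict bound; the last third of [e] restores
   strictness. *)
apply: (@le_lt_trans _ _ (e / 3 + e / 3)); last by lra.
set vk := iter _ _ _; have fvk := fuzzyP (vk : fuzzy X).
apply/(sup_dist_leP _ fu fvk) => a aI.
have tq i : mdist (t i) (iter (k * n) f (y i)) < e / 3.
  by have := interior_subset (hy i _ kl); rewrite ballEmdist.
have lvk : level (vk : fuzzy X) a =
    [set iter (k * n) f (y i) | i in [set i | a <= c i]].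
  by rewrite level_iter_zadeh// level_finite_fuzzy// image_comp.
have [_ ?] := level_ncompact fu aI; have [_ ?] := level_ncompact fvk aI.
apply: hausdorff_dist_le => // [x xa|q].
  have a0 : 0 <= a by case/andP: aI.
  (* The net point satisfies [u x <= u p], so its weight reaches level [a] too. *)
  have [p ps [xp uxp]] := s_net x (level_sub0 a0 xa).
  have [i ti] := t_onto p ps.
  have vkq : level (vk : fuzzy X) a (iter (k * n) f (y i)).
    rewrite lvk; exists i => //=; rewrite /c ti.
    move: a0; rewrite le_eqVlt => /predU1P[<-|a0]; first exact/ltW/s_pos.
    by apply: le_trans uxp; move: xa; rewrite level_pos.
  apply: le_trans (dist_set_le _ vkq) _; apply: le_trans (metric_triangle _ p _) _.
  by apply: lerD; rewrite ltW//; rewrite -ti.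
rewrite lvk => -[i /= ai <-{q}].
have uta : level u a (t i).
  have := aI; rewrite le_eqVlt => /andP[/predU1P[<- _|a0 _]]; last by rewrite level_pos.
  by rewrite level0; apply: subset_closure => /=; apply/s_pos/mem_tnth.
apply: le_trans (dist_set_le _ uta) _; rewrite metric_sym.
by apply: le_trans (ltW (tq i)) _; rewrite lerDl ltW.
Qed.

End Fuzzy_dynamics.

Theorem theorem4p1 (R : realType) (X : metricType R) (l : nat)
    (A : set (set nat)) (f : X -> X)
    (l_gt0 : (0 < l)%N) (hA : furstenberg_family A) (cf : continuous f) :
  [<-> forall N : nat, (0 < N)%N ->
         @topologically_recurrent {ptws 'I_N -> X} l A (fold_product f);
       @topologically_recurrent (hyperspace X) l A (hyper_map cf);
       @topologically_recurrent (fuzzy_sup X) l A (zadeh cf);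
       @topologically_recurrent (fuzzy_skorokhod X) l A (zadeh cf)].
Proof.
tfae.
- move=> rf; apply: (jointly_recurrent_hyper_map hA).
  exact: fold_product_jointly_recurrent hA rf.
- move=> rf; apply: (jointly_recurrent_zadeh cf hA).
  exact: (hyper_map_jointly_recurrent hA rf).
- exact: (topologically_recurrent_factor hA continuous_fuzzy_id).
(* The cycle closes through the hyperspace: the core map yields recurrence there, hence joint
   recurrence. *)
- move=> rz N; apply: (jointly_recurrent_fold_product hA).
  apply: (hyper_map_jointly_recurrent hA (cf := cf)).
  exact: (topologically_recurrent_factor hA continuous_fuzzy_core
    fuzzy_core_surj (fuzzy_core_zadeh cf) rz).
Qed.
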